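(* Let $U\subset\mathbb{R}^m$, $A\subset\mathbb{R}^{m'}$ be compact control sets (not both empty), let $L:\mathbb{R}^n\times\mathbb{R}^{n'}\times U\times A\to\mathbb{R}$ be continuous, and let $F_1:\mathbb{R}^n\times U\times A\to\mathbb{R}^n$, $F_2:\mathbb{R}^n\times U\times A\to\mathbb{R}^{n'}$ be continuous, such that (i) for some $C>0$, $\langle F_1(x,u,a)-F_1(x',u,a),x-x'\rangle\le C|x-x'|^2$ for all $x,x'\in\mathbb{R}^n$, $u\in U$, $a\in A$; (ii) for some $\bar K>0$, $|F_2(x,u,a)|\le\bar K(1+|x|)$ for all $(x,u,a)\in\mathbb{R}^n\times U\times A$, and $x\mapsto F_2(x,u,a)$ is uniformly continuous, uniformly with respect to $(u,a)\in U\times A$; (iii) $L$ is bounded and $(x,z)\mapsto L(x,z,u,a)$ is uniformly continuous, uniformly with respect to $(u,a)\in U\times A$. Let $H:\mathbb{R}^n\times\mathbb{R}^{n'}\times\mathbb{R}^n\times\mathbb{R}^{n'}\to\mathbb{R}$ be defined by $$H(x,z,p_1,p_2):=\min_{a\in A}\max_{u\in U}\Big\{-\langle(p_1,p_2),(F_1(x,u,a),F_2(x,u,a))\rangle-L(x,z,u,a)\Big\}.$$ Given $\sigma>0$, if $v_1,v_2:\mathbb{R}^n\times\mathbb{R}^{n'}\to\mathbb{R}$, bounded and continuous, are, respectively, a viscosity sub- and supersolution of $$\sigma\,v(x,z)+H(x,z,Dv(x,z))=0\qquad\text{for all }(x,z)\in\mathbb{R}^n\times\mathbb{R}^{n'},$$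 then $v_1(x,z)\le v_2(x,z)$ for all $(x,z)\in\mathbb{R}^n\times\mathbb{R}^{n'}$.
   Context: Here $Dv=(D_xv,D_zv)$ denotes the full gradient, and viscosity sub- and supersolutions are understood in the standard sense for continuous functions: $v_1$ is a subsolution if $\sigma v_1(\bar x,\bar z)+H(\bar x,\bar z,D\varphi(\bar x,\bar z))\le0$ whenever $\varphi\in C^1$ and $v_1-\varphi$ has a local maximum at $(\bar x,\bar z)$; $v_2$ is a supersolution if $\sigma v_2(\bar x,\bar z)+H(\bar x,\bar z,D\varphi(\bar x,\bar z))\ge0$ whenever $\varphi\in C^1$ and $v_2-\varphi$ has a local minimum at $(\bar x,\bar z)$. If one of the control sets $U$, $A$ is empty, this is to be read as: the corresponding control variable is absent (from $F_1,F_2,L$ and from the min/max). *)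

(* Defs.v *)
From HB Require Import structures.
From mathcomp Require Import all_boot all_order all_algebra.
From mathcomp Require Import all_classical all_reals all_analysis.

Set Implicit Arguments.
Unset Strict Implicit.
Unset Printing Implicit Defensive.
Import Order.TTheory GRing.Theory Num.Theory.
Import numFieldNormedType.Exports.
Local Open Scope classical_set_scope.
Local Open Scope ring_scope.

Section euclidean.
Context {R : realType}.

Definition dotp {n : nat} (x y : 'rV[R]_n) : R := \sum_(i < n) x 0 i * y 0 i.

(* The library norm on ['rV_n] is the sup norm; this is the Euclidean one. *)
Definition enorm {n : nat} (x : 'rV[R]_n) : R := Num.sqrt (dotp x x).

End euclidean.

Section control.
Context {R : realType}.

(* The set over which a control variable with control set [U] ranges.  An empty
   control set means that the variable is absent; this is encoded by letting it
   range over the one-point set [{0}], so that a function of [u \in [set 0]] is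
   just a constant and the max (or min) over [u] disappears. *)
Definition controls {m : nat} (U : set 'rV[R]_m) : set 'rV[R]_m :=
  if U == set0 then [set 0] else U.

(* Greatest and least element of a set of reals; the default value 0 is only
   taken when there is no such element, which does not happen below for
   continuous functions on compact control sets. *)
Definition set_max (S : set R) : R := xget 0 [set M | S M /\ ubound S M].
Definition set_min (S : set R) : R := xget 0 [set M | S M /\ lbound S M].

Definition hamiltonian {n n' m m' : nat}
    (U : set 'rV[R]_m) (A : set 'rV[R]_m')
    (F1 : 'rV[R]_n -> 'rV[R]_m -> 'rV[R]_m' -> 'rV[R]_n)
    (F2 : 'rV[R]_n -> 'rV[R]_m -> 'rV[R]_m' -> 'rV[R]_n')
    (L : 'rV[R]_n -> 'rV[R]_n' -> 'rV[R]_m -> 'rV[R]_m' -> R)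
    (x : 'rV[R]_n) (z : 'rV[R]_n') (p1 : 'rV[R]_n) (p2 : 'rV[R]_n') : R :=
  set_min [set set_max
      [set - dotp (row_mx p1 p2) (row_mx (F1 x u a) (F2 x u a)) - L x z u a
       | u in controls U]
    | a in controls A].

End control.

Section viscosity.
Context {R : realType} {n n' : nat}.
Implicit Types (phi v : 'rV[R]_n * 'rV[R]_n' -> R) (p : 'rV[R]_n * 'rV[R]_n').

Definition gradx phi p : 'rV[R]_n := \row_i 'D_(delta_mx 0 i, 0) phi p.
Definition gradz phi p : 'rV[R]_n' := \row_i 'D_(0, delta_mx 0 i) phi p.

Definition C1 phi : Prop :=
  [/\ forall p, differentiable phi p,
      continuous (gradx phi) & continuous (gradz phi)].

Definition local_max (f : 'rV[R]_n * 'rV[R]_n' -> R) p : Prop :=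
  \forall q \near p, f q <= f p.
Definition local_min (f : 'rV[R]_n * 'rV[R]_n' -> R) p : Prop :=
  \forall q \near p, f p <= f q.

Variables (sigma : R) (H : 'rV[R]_n -> 'rV[R]_n' -> 'rV[R]_n -> 'rV[R]_n' -> R).

Definition viscosity_subsolution v : Prop :=
  forall phi p, C1 phi -> local_max (fun q => v q - phi q) p ->
    sigma * v p + H p.1 p.2 (gradx phi p) (gradz phi p) <= 0.

Definition viscosity_supersolution v : Prop :=
  forall phi p, C1 phi -> local_min (fun q => v q - phi q) p ->
    0 <= sigma * v p + H p.1 p.2 (gradx phi p) (gradz phi p).

End viscosity.

(* Main.v *)
(* Double the variables and maximize over pairs p = (x,z), q = (y,w)
     v1 p - v2 q - a|x-y|^2 - b|z-w|^2 - c(g p + g q),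
   with g(x,z) = ln(1 + |x|^2 + |z|^2).  The logarithm grows slowly enough for
   <Dg,(F1,F2)> to be bounded above under the one-sided Lipschitz and linear
   growth conditions, and is unbounded, so that the maximum exists.  The two
   viscosity inequalities at the maximum point, together with a common choice
   of controls, bound sigma (v1 p - v2 q) by
     2aC|x-y|^2 + 2b<z-w, F2 x - F2 y> + O(c) + (L p - L q).
   Since F2 is uniformly continuous but not Lipschitz, x and z are penalized at
   different scales: first c is taken small, then b large, and finally a large
   depending on b, so that |F2 x - F2 y|^2 is small compared with 1/b. *)

Require Import Defs.
From HB Require Import structures.
From mathcomp Require Import all_boot all_order all_algebra.
From mathcomp Require Import all_classical all_reals all_analysis.
From mathcomp Require Import ring lra.
Import Order.TTheory GRing.Theory Num.Theory.
Import numFieldNormedType.Exports.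
Local Open Scope classical_set_scope.
Local Open Scope ring_scope.

Set Implicit Arguments.
Unset Strict Implicit.

(** * Extrema of sets of reals, and continuity on subsets *)

Lemma set_maxP (R : realType) (S : set R) :
  (exists2 M, S M & ubound S M) -> S (set_max S) /\ ubound S (set_max S).
Proof.
by move=> [M SM ubM]; apply: (@xgetPex _ 0 [set M | S M /\ ubound S M]); exists M.
Qed.

Lemma set_minP (R : realType) (S : set R) :
  (exists2 M, S M & lbound S M) -> S (set_min S) /\ lbound S (set_min S).
Proof.
by move=> [M SM lbM]; apply: (@xgetPex _ 0 [set M | S M /\ lbound S M]); exists M.
Qed.

Lemma within_continuous_precomp {T U V : topologicalType} (A : set T) (B : set U)
    (f : T -> U) (g : U -> V) :
  continuous f -> (forall x, A x -> B (f x)) -> {within B, continuous g} ->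
  {within A, continuous (g \o f)}.
Proof.
move=> cf fAB /subspace_continuousP cg; apply/subspace_continuousP => x Ax.
apply: cvg_trans (cg _ (fAB _ Ax)) => W; rewrite /= !nbhs_filterE /= /within /=.
by move=> /cf; rewrite nbhs_filterE/=; apply: filterS => y /= gW /fAB.
Qed.

Lemma within_continuous_section {X T1 T2 V : topologicalType}
    (U : set T1) (A : set T2) (f : X * T1 * T2 -> V) (x : X) :
  {within setT `*` U `*` A, continuous f} ->
  {within U `*` A, continuous (fun q => f (x, q.1, q.2))}.
Proof.
move=> cf; apply: (@within_continuous_precomp _ _ _ _ _
  (fun q => (x, q.1, q.2)) f _ _ cf).
  move=> q; have cx : (fun=> x) @ q --> x by exact: cvg_cst.
  have c1 : fst @ q --> q.1 by exact: cvg_fst.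
  have c2 : snd @ q --> q.2 by exact: cvg_snd.
  exact: (cvg_pair (cvg_pair cx c1) c2).
by move=> [u a] [].
Qed.

(** * Attainment of the min-max over compact sets *)

Section minmax.
Context {R : realType} {T1 T2 : topologicalType}.
Variables (U : set T1) (A : set T2) (h : T1 -> T2 -> R).
Hypotheses (U0 : U !=set0) (A0 : A !=set0) (cU : compact U) (cA : compact A).
Hypothesis hcont : {within U `*` A, continuous (fun q => h q.1 q.2)}.

Let G a := set_max [set h u a | u in U].

Lemma set_max_attained a : A a ->
  (exists2 u, U u & h u a = G a) /\ forall u, U u -> h u a <= G a.
Proof.
move=> Aa; have hUc : {within U, continuous (h^~ a)}.
  apply: (@within_continuous_precomp _ _ _ _ _ (fun u => (u, a)) _ _ _ hcont).
    by move=> u; apply: cvg_pair => //; exact: cvg_cst.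
  by move=> u Uu.
have [u uU umax] := compact_EVT_max U0 cU hUc.
have [| [u' Uu' hu'] ub] := @set_maxP R [set h u a | u in U].
  exists (h u a); first by exists u => //; exact: set_mem.
  by move=> _ [u' Uu' <-]; exact/umax/mem_set.
by split=> [|v Uv]; [exists u'|apply: ub; exists v].
Qed.

(** If the infimum of [G] were not attained, [G] would exceed it near each point of [A] by lower
    semicontinuity, hence by one common margin on all of [A] by compactness; this contradicts the
    definition of the infimum. *)
Lemma set_min_attained :
  (exists2 a, A a & G a = set_min [set G a | a in A]) /\
  forall a, A a -> set_min [set G a | a in A] <= G a.
Proof.
have [| [a Aa Ga] lb] := @set_minP R [set G a | a in A]; last first.
  by split=> [|b Ab]; [exists a|apply: lb; exists b].
have [u0 Uu0] := U0.
(* The minimum of [h] over the product bounds [G] from below, since [G a] dominates [h u0 a]. *)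
have [|q _ qmin] := compact_EVT_min _ (compact_setX cU cA) hcont.
  by case: U0 A0 => u Uu [a Aa]; exists (u, a).
have hasG : has_inf [set G a | a in A].
  split; first by case: A0 => a Aa; exists (G a), a.
  exists (h q.1 q.2) => _ [a Aa <-].
  have [_ /(_ _ Uu0)] := set_max_attained Aa; apply: le_trans.
  by apply: (qmin (u0, a)); rewrite inE.
set I := inf [set G a | a in A].
have IG a : A a -> I <= G a by move=> Aa; apply: ge_inf; [exact: hasG.2|exists a].
have [[a Aa GaI]|noa] := pselect (exists2 a, A a & G a <= I).
  exists (G a); first by exists a.
  by move=> _ [b Ab <-]; exact: le_trans GaI (IG _ Ab).
(* [G] is lower semicontinuous as a supremum of continuous functions *)
have iG : \forall i \near I^'+, A `<=` (fun a => A a -> i < G a).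
  apply: ((compact_near_coveringP A).1 cA) => a Aa.
  have {noa} IGa : I < G a by rewrite ltNge; apply/negP => GaI; apply: noa; exists a.
  have [[u Uu hu] _] := set_max_attained Aa.
  pose c := (I + G a) / 2.
  have [Ic cG] : I < c /\ c < G a by rewrite /c; split; lra.
  have hac : {within A, continuous (h u)}.
    apply: (@within_continuous_precomp _ _ _ _ _ (fun a => (u, a)) _ _ _ hcont).
      by move=> b; apply: cvg_pair => //; exact: cvg_cst.
    by move=> b Ab.
  have near_a : \forall b \near within A (nbhs a), c < h u b.
    move/subspace_continuousP: hac => /(_ a Aa) hac.
    by apply: (cvgr_gt (h u a) hac); rewrite hu.
  exists ([set b | A b -> c < h u b], [set i | i < c]) => /=.
    by split; [exact: near_a|exact: nbhs_right_lt].
  move=> [b i] /= [cb ic] Ab; apply: (lt_le_trans (lt_trans ic (cb Ab))).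
  by have [_] := set_max_attained Ab; apply.
have [i [/= Ii AG]] := filter_ex (filterI (nbhs_right_gt I) iG).
have iI0 : 0 < i - I by rewrite subr_gt0.
have [_ [a Aa <-]] := inf_adherent iI0 hasG.
by rewrite -/I addrC subrK ltNge (ltW (AG _ Aa Aa)).
Qed.
End minmax.

(** * Differentiation rules *)

Section is_diff.
Context {R : realType}.
Implicit Types V W : normedModType R.

Lemma is_diff_linear V W (f : {linear V -> W}) (x : V) :
  continuous f -> is_diff x f f.
Proof.
by move=> cf; apply: DiffDef; [exact: linear_differentiable|exact: diff_lin].
Qed.

Lemma is_diff_fst V W (p : V * W) : is_diff p fst fst.
Proof. by apply: is_diff_linear => q; exact: cvg_fst. Qed.

Lemma is_diff_snd V W (p : V * W) : is_diff p snd snd.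
Proof. by apply: is_diff_linear => q; exact: cvg_snd. Qed.

Lemma is_diff_sum V W n (F dF : 'I_n -> V -> W) (p : V) :
  (forall i, is_diff p (F i) (dF i)) ->
  is_diff p (fun q => \sum_(i < n) F i q) (fun h => \sum_(i < n) dF i h).
Proof.
move=> hF.
have -> : (fun q => \sum_(i < n) F i q) = \sum_(i < n) F i.
  by apply/funext => q; rewrite fct_sumE.
have -> : (fun q => \sum_(i < n) dF i q) = \sum_(i < n) dF i.
  by apply/funext => q; rewrite fct_sumE.
elim/big_ind2 : _ => // [|f df g dg hf hg]; first exact: is_diff_cst.
exact: is_diffD.
Qed.

Lemma is_diff_coord n (x : 'rV[R]_n) i :
  is_diff x (fun y : 'rV[R]_n => y 0 i) (fun y : 'rV[R]_n => y 0 i).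
Proof.
have lin : linear (fun y : 'rV[R]_n => y 0 i : R^o) by move=> a u v; rewrite !mxE.
pose f : {linear 'rV[R]_n -> R^o} := HB.pack (fun y : 'rV[R]_n => y 0 i : R^o)
  (GRing.isLinear.Build _ _ _ _ _ lin).
by apply: (@is_diff_linear _ _ f); exact: coord_continuous.
Qed.

Lemma is_diff_dotp V n (f df g dg : V -> 'rV[R]_n) (p : V) :
  is_diff p f df -> is_diff p g dg ->
  is_diff p (fun q => dotp (f q) (g q))
            (fun h => dotp (f p) (dg h) + dotp (g p) (df h)).
Proof.
move=> hf hg.
rewrite (_ : (fun h => _ + _) = (fun h => \sum_(i < n)
    (f p 0 i * dg h 0 i + g p 0 i * df h 0 i))); last first.
  by apply/funext => h; rewrite big_split.
have coordf (k dk : V -> 'rV[R]_n) i : is_diff p k dk ->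
    is_diff p (fun q => k q 0 i : R) (fun h => dk h 0 i : R).
  by move=> hk; exact: (is_diff_comp hk (is_diff_coord _ i)).
apply: is_diff_sum => i.
exact: (is_diffM (coordf _ _ i hf) (coordf _ _ i hg)).
Qed.

Lemma is_diff_ln V (f df : V -> R) (p : V) : 0 < f p -> is_diff p f df ->
  is_diff p (fun q => ln (f q)) (fun h => (f p)^-1 * df h).
Proof.
move=> fp0 hf; have hl := is_derive1_ln fp0.
have dln : is_diff (f p) (@ln R) (fun h : R => (f p)^-1 * h).
  apply: DiffDef; first exact/derivable1_diffP.
  rewrite deriv1E// derive1E (@derive_val _ _ _ _ _ _ _ hl).
  by apply/funext => h; rewrite mulrC.
exact: (@is_diff_comp _ _ _ _ f df _ _ p hf dln).
Qed.
End is_diff.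

(** * The Euclidean inner product *)

Section dotp_theory.
Context {R : realType} {n : nat}.
Implicit Types x y z : 'rV[R]_n.

Lemma dotpC x y : dotp x y = dotp y x.
Proof. by apply: eq_bigr => i _; rewrite mulrC. Qed.

Lemma dotpDr x y z : dotp x (y + z) = dotp x y + dotp x z.
Proof. by rewrite -big_split; apply: eq_bigr => i _; rewrite mxE mulrDr. Qed.

Lemma dotpZr a x y : dotp x (a *: y) = a * dotp x y.
Proof. by rewrite big_distrr; apply: eq_bigr => i _; rewrite mxE/= mulrCA. Qed.

Lemma dotpNr x y : dotp x (- y) = - dotp x y.
Proof. by rewrite -scaleN1r dotpZr mulN1r. Qed.

Lemma dotp0r x : dotp x 0 = 0.
Proof. by rewrite -(scale0r 0) dotpZr mul0r. Qed.

Lemma dotpDl x y z : dotp (x + y) z = dotp x z + dotp y z.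
Proof. by rewrite dotpC dotpDr !(dotpC z). Qed.

Lemma dotpNl x y : dotp (- x) y = - dotp x y.
Proof. by rewrite dotpC dotpNr dotpC. Qed.

Lemma dotpZl a x y : dotp (a *: x) y = a * dotp x y.
Proof. by rewrite dotpC dotpZr dotpC. Qed.

Definition dotpE := (dotpDl, dotpDr, dotpNl, dotpNr, dotpZl, dotpZr).

Lemma dotp_ge0 x : 0 <= dotp x x.
Proof. by apply: sumr_ge0 => i _; rewrite -expr2 sqr_ge0. Qed.

Lemma sqr_enorm x : enorm x ^+ 2 = dotp x x.
Proof. by rewrite sqr_sqrtr// dotp_ge0. Qed.

Lemma enorm_lt x r : 0 < r -> dotp x x < r ^+ 2 -> enorm x < r.
Proof.
by move=> r0; rewrite -sqr_enorm ltr_pXn2r// nnegrE ?sqrtr_ge0// ltW.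
Qed.

Lemma dotp_delta x i : dotp x (delta_mx 0 i) = x 0 i.
Proof.
rewrite /dotp (bigD1 i)//= mxE !eqxx mulr1 big1 ?addr0// => j ji.
by rewrite mxE (negbTE ji) andbF mulr0.
Qed.

Lemma sqr_coord_le x i : x 0 i ^+ 2 <= dotp x x.
Proof.
rewrite /dotp (bigD1 i)//= -expr2 lerDl.
by apply: sumr_ge0 => j _; rewrite -expr2 sqr_ge0.
Qed.

(** Expansion of the square of [t *: x - y]. The weight [t] is left free so that it can be tuned to
    the modulus of continuity of [F2]. *)
Lemma dotp_young t x y : 0 < t -> 2 * dotp x y <= t * dotp x x + t^-1 * dotp y y.
Proof.
move=> t0; rewrite -subr_ge0.
suff -> : t * dotp x x + t^-1 * dotp y y - 2 * dotp x y =
          t^-1 * dotp (t *: x - y) (t *: x - y).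
  by rewrite mulr_ge0 ?dotp_ge0// invr_ge0 ltW.
by rewrite !dotpE (dotpC y x); field; rewrite gt_eqF.
Qed.

Lemma continuous_dotp : continuous (fun q : 'rV[R]_n * 'rV[R]_n => dotp q.1 q.2).
Proof.
move=> q; apply: differentiable_continuous.
exact: (@ex_diff _ _ _ _ _ _ _ (is_diff_dotp (is_diff_fst q) (is_diff_snd q))).
Qed.

Lemma cvg_dotp (T : Type) (F : set_system T) (FF : Filter F)
    (f g : T -> 'rV[R]_n) x y :
  f @ F --> x -> g @ F --> y -> (fun t => dotp (f t) (g t)) @ F --> dotp x y.
Proof.
move=> fx gy; have fg : (fun t => (f t, g t)) @ F --> (x, y) by exact: (cvg_pair fx gy).
exact: (cvg_comp _ _ fg (@continuous_dotp (x, y))).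
Qed.

End dotp_theory.

Lemma dotp_row_mx (R : realType) n n' (x y : 'rV[R]_n) (z w : 'rV[R]_n') :
  dotp (row_mx x z) (row_mx y w) = dotp x y + dotp z w.
Proof.
by rewrite /dotp big_split_ord/=; congr (_ + _); apply: eq_bigr => i _;
  rewrite ?row_mxEl ?row_mxEr.
Qed.

Section controls.
Context {R : realType} {m : nat}.
Variable U : set 'rV[R]_m.

Lemma controls_neq0 : controls U !=set0.
Proof. by rewrite /controls; case: eqP => [_|/eqP/set0P//]; exists 0. Qed.

Lemma compact_controls : compact U -> compact (controls U).
Proof. by rewrite /controls; case: eqP => // _ _; exact: compact_set1. Qed.

End controls.

(** * The logarithmic penalty and the test functions *)

Section test_function.
Context {R : realType} {n n' : nat}.
Notation E := ('rV[R]_n * 'rV[R]_n')%type.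
Implicit Types (p q : E).

Definition sqnorm1 p : R := 1 + (dotp p.1 p.1 + dotp p.2 p.2).

Lemma sqnorm1_ge1 p : 1 <= sqnorm1 p.
Proof. by rewrite lerDl addr_ge0// dotp_ge0. Qed.

Lemma sqnorm1_gt0 p : 0 < sqnorm1 p.
Proof. exact: lt_le_trans ltr01 (sqnorm1_ge1 p). Qed.

Definition penalty p : R := ln (sqnorm1 p).

Lemma penalty_ge0 p : 0 <= penalty p.
Proof. exact/ln_ge0/sqnorm1_ge1. Qed.

Lemma penalty0 : penalty 0 = 0.
Proof. by rewrite /penalty /sqnorm1 !dotp0r !addr0 ln1. Qed.

(** The part of the penalization that depends on [p] once [q] is frozen. Negating all three
    coefficients gives the test function for the supersolution. *)
Definition test (a b c : R) q p : R :=
  a * dotp (p.1 - q.1) (p.1 - q.1) + b * dotp (p.2 - q.2) (p.2 - q.2)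
  + c * penalty p.

Lemma is_diff_sqnorm1 p :
  is_diff p sqnorm1 (fun h => 2 * dotp p.1 h.1 + 2 * dotp p.2 h.2).
Proof.
have h1 := is_diff_dotp (is_diff_fst p) (is_diff_fst p).
have h2 := is_diff_dotp (is_diff_snd p) (is_diff_snd p).
have h0 : is_diff p (cst (1 : R)) (0 : E -> R) := is_diff_cst (1 : R) p.
have h3 := is_diffD h0 (is_diffD h1 h2).
have -> : sqnorm1 = cst (1 : R) +
  ((fun q : E => dotp q.1 q.1) + (fun q => dotp q.2 q.2)) by [].
apply: (is_diff_eq h3); apply/funext => h.
(* The differential assembled by the rules is a sum of functions; conversion unfolds it to this
   pointwise form, on which [ring] works. *)
transitivity (0 + (dotp p.1 h.1 + dotp p.1 h.1 + (dotp p.2 h.2 + dotp p.2 h.2))).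
  by [].
by ring.
Qed.

Lemma is_diff_sqdist k (f df : E -> 'rV[R]_k) (y : 'rV[R]_k) p : is_diff p f df ->
  is_diff p (fun q => dotp (f q - y) (f q - y)) (fun h => 2 * dotp (f p - y) (df h)).
Proof.
move=> hf; have hfy := is_diffB hf (is_diff_cst y p).
apply: (is_diff_eq (is_diff_dotp hfy hfy)); apply/funext => h.
transitivity (dotp (f p - y) (df h - 0) + dotp (f p - y) (df h - 0)); first by [].
by rewrite subr0; ring.
Qed.

Lemma is_diff_test a b c q p : is_diff p (test a b c q)
  (fun h => 2 * a * dotp (p.1 - q.1) h.1 + 2 * b * dotp (p.2 - q.2) h.2
     + 2 * c / sqnorm1 p * (dotp p.1 h.1 + dotp p.2 h.2)).
Proof.
have h1 := is_diffZ a (is_diff_sqdist q.1 (is_diff_fst p)).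
have h2 := is_diffZ b (is_diff_sqdist q.2 (is_diff_snd p)).
have h3 := is_diffZ c (is_diff_ln (sqnorm1_gt0 p) (is_diff_sqnorm1 p)).
apply: (is_diff_eq (is_diffD (is_diffD h1 h2) h3)); apply/funext => h.
transitivity (a * (2 * dotp (p.1 - q.1) h.1) + b * (2 * dotp (p.2 - q.2) h.2) +
   c * ((sqnorm1 p)^-1 * (2 * dotp p.1 h.1 + 2 * dotp p.2 h.2))); first by [].
by field; rewrite gt_eqF ?sqnorm1_gt0.
Qed.

Lemma differentiable_test a b c q p : differentiable (test a b c q) p.
Proof. exact: (@ex_diff _ _ _ _ _ _ _ (is_diff_test a b c q p)). Qed.

Lemma derive_test a b c q p h : 'D_h (test a b c q) p =
  2 * a * dotp (p.1 - q.1) h.1 + 2 * b * dotp (p.2 - q.2) h.2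
     + 2 * c / sqnorm1 p * (dotp p.1 h.1 + dotp p.2 h.2).
Proof.
rewrite deriveE; last exact: differentiable_test.
by rewrite (@diff_val _ _ _ _ _ _ _ (is_diff_test a b c q p)).
Qed.

Lemma gradx_test a b c q p : gradx (test a b c q) p =
  (2 * a) *: (p.1 - q.1) + (2 * c / sqnorm1 p) *: p.1.
Proof.
apply/rowP => i; rewrite mxE derive_test/= !dotp_delta !dotp0r !mxE.
by rewrite mulr0 !addr0.
Qed.

Lemma gradz_test a b c q p : gradz (test a b c q) p =
  (2 * b) *: (p.2 - q.2) + (2 * c / sqnorm1 p) *: p.2.
Proof.
apply/rowP => i; rewrite mxE derive_test/= !dotp_delta !dotp0r !mxE.
by rewrite mulr0 !add0r.
Qed.

Lemma continuous_sqnorm1 : continuous sqnorm1.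
Proof.
move=> p; apply: differentiable_continuous.
exact: (@ex_diff _ _ _ _ _ _ _ (is_diff_sqnorm1 p)).
Qed.

Lemma continuous_penalty : continuous penalty.
Proof.
move=> p; apply: differentiable_continuous.
exact: (@ex_diff _ _ _ _ _ _ _ (is_diff_ln (sqnorm1_gt0 p) (is_diff_sqnorm1 p))).
Qed.

Lemma C1_test a b c q : C1 (test a b c q).
Proof.
have cN p : (fun p => 2 * c / sqnorm1 p) @ p --> 2 * c / sqnorm1 p.
  apply: cvgM; first exact: cvg_cst.
  by apply: cvgV; [rewrite gt_eqF ?sqnorm1_gt0|exact: continuous_sqnorm1].
split; first exact: differentiable_test.
- move=> p; rewrite (funext (gradx_test a b c q)).
  apply: cvgD; last by apply: cvgZ; [exact: cN|exact: cvg_fst].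
  by apply: cvgZr; apply: cvgB; [exact: cvg_fst|exact: cvg_cst].
- move=> p; rewrite (funext (gradz_test a b c q)).
  apply: cvgD; last by apply: cvgZ; [exact: cN|exact: cvg_snd].
  by apply: cvgZr; apply: cvgB; [exact: cvg_snd|exact: cvg_cst].
Qed.

(** Cubes are compact as products of segments, and outside a large one some coordinate is so big
    that [sqnorm1] exceeds [expR T]. *)
Lemma penalty_coercive T : exists2 K : set E, compact K &
  K 0 /\ forall p, ~ K p -> T <= penalty p.
Proof.
pose r := expR T + 1.
have r1 : 1 <= r by rewrite /r lerDr expR_ge0.
pose B k : set 'rV[R]_k := [set v | forall i, `[- r, r]%classic (v 0 i)].
have cB k : compact (B k).
  by apply: (@rV_compact _ _ (fun=> `[- r, r]%classic)) => i; exact: segment_compact.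
have B0 k : B k 0 by move=> i; rewrite mxE /= in_itv/=; lra.
have notB k (v : 'rV[R]_k) : ~ B k v -> r <= dotp v v.
  move=> /existsNP[i]; rewrite /= in_itv/= => /negP vi.
  apply: le_trans (sqr_coord_le v i).
  (* As [r >= 1], a coordinate beyond [r] in absolute value has square at least [r]. *)
  rewrite expr2; move: vi; rewrite negb_and -!ltNge => /orP[] ?; nra.
exists (B n `*` B n'); first exact: compact_setX.
split=> [|p /not_andP pK]; first by split; exact: B0.
rewrite -ler_expR lnK ?posrE ?sqnorm1_gt0// /sqnorm1.
have := dotp_ge0 p.1; have := dotp_ge0 p.2.
by case: pK => /notB; rewrite /r; lra.
Qed.

End test_function.

(* Since [a S(t_a)] is bounded by twice the decrease of the maximum of
   [Psi - a S] when [a] doubles, it is small for some arbitrarily large [a]. *)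
Lemma penalization_small (R : realType) (T : Type) (Psi S : T -> R) (B : R) (t0 : T) :
  (forall t, Psi t <= B) -> (forall t, 0 <= S t) -> S t0 = 0 ->
  (forall a, 0 < a -> exists t, forall s, Psi s - a * S s <= Psi t - a * S t) ->
  forall a0 eta, 0 < a0 -> 0 < eta -> exists a t,
    [/\ a0 <= a, forall s, Psi s - a * S s <= Psi t - a * S t & a * S t <= eta].
Proof.
move=> PsiB S0 St0 attained a0 eta a00 eta0.
pose a k : R := a0 * 2 ^+ k.
have a_gt0 k : 0 < a k by rewrite mulr_gt0// exprn_gt0.
have aS k : a k.+1 = 2 * a k by rewrite /a exprS mulrCA.
have [t tmax] := choice (fun k => attained (a k) (a_gt0 k)).
pose M k := Psi (t k) - a k * S (t k).
have decr k : a k.+1 * S (t k.+1) <= 2 * (M k - M k.+1).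
  by have := tmax k (t k.+1); rewrite /M aS; nra.
have Mlb k : Psi t0 <= M k by have := tmax k t0; rewrite St0 mulr0 subr0.
have [[k hk]|noK] := pselect (exists k, a k.+1 * S (t k.+1) <= eta).
  exists (a k.+1), (t k.+1); split => //.
  by rewrite ler_peMr ?exprn_ege1 ?ler1n// ltW.
(* If the product stayed above [eta] at every scale, the maxima would drop by at least [eta / 2] per
   doubling and eventually fall below [Psi t0]. *)
have Mdecr k : M k <= M 0%N - k%:R * (eta / 2).
  elim: k => [|k IH]; first by rewrite mul0r subr0.
  have : eta < a k.+1 * S (t k.+1).
    by rewrite ltNge; apply/negP => h; apply: noK; exists k.
  by have := decr k; rewrite -(natr1 k) mulrDl mul1r; lra.
have M0B : M 0%N <= B.
  have := PsiB (t 0%N); have := mulr_ge0 (ltW (a_gt0 0%N)) (S0 (t 0%N)).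
  by rewrite /M; lra.
have := Mdecr (Num.bound (2 * (B - Psi t0) / eta)).
have : 2 * (B - Psi t0) / eta < (Num.bound (2 * (B - Psi t0) / eta))%:R.
  apply: archi_boundP; rewrite divr_ge0 ?(ltW eta0)// mulr_ge0// subr_ge0.
  exact: le_trans (Mlb 0%N) M0B.
set k := Num.bound _; rewrite ltr_pdivrMr// => hk Mk.
by have := Mlb k; lra.
Qed.

(** * Doubling of variables and existence of maximizers *)

Section doubling.
Context {R : realType} {n n' : nat}.
Notation E := ('rV[R]_n * 'rV[R]_n')%type.
Variables (v1 v2 : E -> R) (M : R).
Hypotheses (v1M : forall p, `|v1 p| <= M) (v2M : forall p, `|v2 p| <= M).
Hypotheses (v1c : continuous v1) (v2c : continuous v2).

Definition sqdist {k : nat} (x y : 'rV[R]_k) : R := dotp (x - y) (x - y).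

(** The term in [a] is kept out because [a] is chosen last: this function plays the role of [Psi] in
    [penalization_small]. *)
Definition doubled (b c : R) (t : E * E) : R :=
  v1 t.1 - v2 t.2 - b * sqdist t.1.2 t.2.2 - c * (penalty t.1 + penalty t.2).

Lemma continuous_doubled b c : continuous (doubled b c).
Proof.
move=> t; have c1 : fst @ t --> t.1 by exact: cvg_fst.
have c2 : snd @ t --> t.2 by exact: cvg_snd.
apply: cvgB; first apply: cvgB; first apply: cvgB.
- exact: (cvg_comp _ _ c1 (@v1c t.1)).
- exact: (cvg_comp _ _ c2 (@v2c t.2)).
- apply: cvgM; first exact: cvg_cst.
  apply: cvg_dotp; apply: cvgB.
  + exact: (cvg_comp _ _ c1 cvg_snd).
  + exact: (cvg_comp _ _ c2 cvg_snd).
  + exact: (cvg_comp _ _ c1 cvg_snd).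
  + exact: (cvg_comp _ _ c2 cvg_snd).
- apply: cvgM; first exact: cvg_cst.
  apply: cvgD.
    exact: (cvg_comp _ _ c1 (@continuous_penalty _ _ _ t.1)).
  exact: (cvg_comp _ _ c2 (@continuous_penalty _ _ _ t.2)).
Qed.

Lemma continuous_sqdist1 : continuous (fun t : E * E => sqdist t.1.1 t.2.1).
Proof.
move=> t; have c1 : fst @ t --> t.1 by exact: cvg_fst.
have c2 : snd @ t --> t.2 by exact: cvg_snd.
apply: cvg_dotp; apply: cvgB.
- exact: (cvg_comp _ _ c1 cvg_fst).
- exact: (cvg_comp _ _ c2 cvg_fst).
- exact: (cvg_comp _ _ c1 cvg_fst).
- exact: (cvg_comp _ _ c2 cvg_fst).
Qed.

Lemma doubled_le b c t : 0 <= b -> 0 <= c -> doubled b c t <= M + M.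
Proof.
move=> b0 c0; rewrite /doubled.
have := mulr_ge0 b0 (dotp_ge0 (t.1.2 - t.2.2)).
have := mulr_ge0 c0 (penalty_ge0 t.1); have := mulr_ge0 c0 (penalty_ge0 t.2).
have := v1M t.1; have := v2M t.2; rewrite !ler_norml /sqdist mulrDr.
by move=> /andP[? ?] /andP[? ?]; lra.
Qed.

Lemma doubled_attained a b c : 0 < a -> 0 <= b -> 0 < c ->
  exists t, forall s, doubled b c s - a * sqdist s.1.1 s.2.1
                   <= doubled b c t - a * sqdist t.1.1 t.2.1.
Proof.
move=> a0 b0 c0.
(* With this threshold the penalty costs at least [4 * M] outside [K] x [K]. The value there is at
   most [- 2 * M], which the origin already reaches. *)
have [K cK [K0 Kout]] := @penalty_coercive R n n' (4 * M / c).
pose Phi t := doubled b c t - a * sqdist t.1.1 t.2.1.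
have Phic : continuous Phi.
  move=> t; apply: cvgB; first exact: continuous_doubled.
  by apply: cvgM; [exact: cvg_cst|exact: continuous_sqdist1].
have [|t tK tmax] := compact_EVT_max _ (compact_setX cK cK) (continuous_subspaceT Phic).
  by exists (0, 0).
exists t => s; have [sK|sK] := pselect ((K `*` K) s); first exact/tmax/mem_set.
have : - M - M <= Phi (0, 0).
  rewrite /Phi /doubled /sqdist/= !subrr !dotp0r !penalty0 !mulr0 addr0 mulr0.
  by have := v1M 0; have := v2M 0; rewrite !ler_norml => /andP[? ?] /andP[? ?]; lra.
move=> /le_trans; move: (tmax (0, 0)); rewrite inE => /(_ (conj K0 K0)).
move=> h0 /(_ _ h0); apply: le_trans.
have : 4 * M / c <= penalty s.1 + penalty s.2.
  have := penalty_ge0 s.1; have := penalty_ge0 s.2.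
  by move/not_andP: sK => [] /Kout; lra.
rewrite ler_pdivrMr// mulrC => hpen.
have := mulr_ge0 b0 (dotp_ge0 (s.1.2 - s.2.2)).
have := mulr_ge0 (ltW a0) (dotp_ge0 (s.1.1 - s.2.1)).
have := v1M s.1; have := v2M s.2; rewrite !ler_norml.
by rewrite /Phi /doubled /sqdist => /andP[? ?] /andP[? ?]; lra.
Qed.

End doubling.

Lemma sqdistC (R : realType) n (x y : 'rV[R]_n) : sqdist x y = sqdist y x.
Proof. by rewrite /sqdist -opprB dotpNl dotpNr opprK. Qed.

(** * The Hamiltonian and the growth of the dynamics *)

Section comparison.
Context {R : realType} {n n' m m' : nat}.
Notation E := ('rV[R]_n * 'rV[R]_n')%type.
Variables (U : set 'rV[R]_m) (A : set 'rV[R]_m').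
Variables (F1 : 'rV[R]_n -> 'rV[R]_m -> 'rV[R]_m' -> 'rV[R]_n)
    (F2 : 'rV[R]_n -> 'rV[R]_m -> 'rV[R]_m' -> 'rV[R]_n')
    (L : 'rV[R]_n -> 'rV[R]_n' -> 'rV[R]_m -> 'rV[R]_m' -> R).
Hypotheses (hU : compact U) (hA : compact A).
Hypothesis hLcont : {within [set: E] `*` controls U `*` controls A,
  continuous (fun q : E * 'rV[R]_m * 'rV[R]_m' => L q.1.1.1 q.1.1.2 q.1.2 q.2)}.
Hypothesis hF1cont : {within [set: 'rV[R]_n] `*` controls U `*` controls A,
  continuous (fun q : 'rV[R]_n * 'rV[R]_m * 'rV[R]_m' => F1 q.1.1 q.1.2 q.2)}.
Hypothesis hF2cont : {within [set: 'rV[R]_n] `*` controls U `*` controls A,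
  continuous (fun q : 'rV[R]_n * 'rV[R]_m * 'rV[R]_m' => F2 q.1.1 q.1.2 q.2)}.

Let h x z p1 p2 u a : R := - (dotp p1 (F1 x u a) + dotp p2 (F2 x u a)) - L x z u a.

(** A minimizing [a] gives the first half, a maximizing [u] against a given [a] the second. These
    one-sided bounds let a single pair of controls serve at two different points. *)
Lemma hamiltonian_attained x z p1 p2 :
  (exists2 a, controls A a & forall u, controls U u ->
     h x z p1 p2 u a <= hamiltonian U A F1 F2 L x z p1 p2) /\
  (forall a, controls A a -> exists2 u, controls U u &
     hamiltonian U A F1 F2 L x z p1 p2 <= h x z p1 p2 u a).
Proof.
have hc : {within controls U `*` controls A,
    continuous (fun q => h x z p1 p2 q.1 q.2)}.
  have c1 := within_continuous_section (x := x) hF1cont.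
  have c2 := within_continuous_section (x := x) hF2cont.
  have c3 := within_continuous_section (x := (x, z)) hLcont.
  move: c1 c2 c3 => /subspace_continuousP c1 /subspace_continuousP c2.
  move=> /subspace_continuousP c3; apply/subspace_continuousP => q Kq.
  apply: cvgB; last exact: c3.
  apply: cvgN; apply: cvgD; apply: cvg_dotp; try exact: cvg_cst.
    exact: c1.
  exact: c2.
have U0 := controls_neq0 U; have A0 := controls_neq0 A.
have cU := compact_controls hU; have cA := compact_controls hA.
have -> : hamiltonian U A F1 F2 L x z p1 p2 = set_min
    [set set_max [set h x z p1 p2 u a | u in controls U] | a in controls A].
  rewrite /hamiltonian; congr set_min; apply: eq_imagel => a _.
  by congr set_max; apply: eq_imagel => u _; rewrite dotp_row_mx.
have [[a Aa <-] minle] := set_min_attained U0 A0 cU cA hc.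
have maxP := set_max_attained U0 cU hc.
split=> [|b Ab].
  by exists a => // u Uu; have [_] := maxP a Aa; apply.
have [[u Uu hu] _] := maxP b Ab.
by exists u => //; rewrite hu; exact: minle.
Qed.

(** Continuity on the compact control sets. Together with the one-sided Lipschitz condition between
    [x] and [0], this bounds the product of [x] with [F1 x u a] from above. *)
Lemma F1_at0_bounded : exists2 B, 0 < B & forall u a, controls U u -> controls A a ->
  dotp (F1 0 u a) (F1 0 u a) <= B.
Proof.
have /subspace_continuousP c1 := within_continuous_section (x := (0 : 'rV[R]_n)) hF1cont.
have [|||q _ qmax] := @compact_EVT_max _ R
    (fun q => dotp (F1 0 q.1 q.2) (F1 0 q.1 q.2)) (controls U `*` controls A).
- have [u Uu] := controls_neq0 U; have [a Aa] := controls_neq0 A.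
  by exists (u, a).
- by apply: compact_setX; exact: compact_controls.
- apply/subspace_continuousP => q Kq.
  by apply: cvg_dotp; exact: c1.
exists (1 + dotp (F1 0 q.1 q.2) (F1 0 q.1 q.2)) => [|u a Uu Aa].
  by rewrite ltr_pwDl// dotp_ge0.
apply: (le_trans (qmax (u, a) _)); first by rewrite inE.
by rewrite lerDr.
Qed.

(** Half the derivative of [sqnorm1] along [(F1, F2)]; multiplied by [2 / sqnorm1 p] it is the
    derivative of [penalty]. *)
Let drift (p : E) u a : R := dotp p.1 (F1 p.1 u a) + dotp p.2 (F2 p.1 u a).

(** The one-sided Lipschitz condition against the origin bounds the [F1] part quadratically, and
    Young's inequality with linear growth does so for the [F2] part. Division by [sqnorm1] leaves a
    constant. *)
Lemma drift_le :
  (exists2 C : R, 0 < C &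
     forall x x' u a, controls U u -> controls A a ->
       dotp (F1 x u a - F1 x' u a) (x - x') <= C * enorm (x - x') ^+ 2) ->
  (exists2 K : R, 0 < K &
     forall x u a, controls U u -> controls A a ->
       enorm (F2 x u a) <= K * (1 + enorm x)) ->
  exists2 K : R, 0 < K & forall p u a, controls U u -> controls A a ->
    2 / sqnorm1 p * drift p u a <= K.
Proof.
move=> [C C0 hF1] [K K0 hF2].
have [B B0 hB] := F1_at0_bounded.
have K2 : 0 <= K ^+ 2 by rewrite sqr_ge0.
exists (2 * (C + 1 + B + K ^+ 2)) => [|p u a Uu Aa]; first by lra.
rewrite mulrAC ler_pdivrMr ?sqnorm1_gt0// -mulrA ler_pM2l// /sqnorm1 /drift.
have e1 := hF1 p.1 0 u a Uu Aa.
rewrite sqr_enorm subr0 !dotpE !(dotpC _ p.1) in e1.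
have e2 := dotp_young p.1 (F1 0 u a) ltr01.
rewrite invr1 !mul1r in e2.
have e3 := dotp_young p.2 (F2 p.1 u a) ltr01.
rewrite invr1 !mul1r -(sqr_enorm (F2 _ _ _)) in e3.
have e4 := hB u a Uu Aa.
have e5 : enorm (F2 p.1 u a) ^+ 2 <= K ^+ 2 * (2 * (1 + dotp p.1 p.1)).
  apply: (@le_trans _ _ ((K * (1 + enorm p.1)) ^+ 2)).
    apply: lerXn2r (hF2 _ _ _ Uu Aa); rewrite nnegrE ?sqrtr_ge0//.
    by rewrite mulr_ge0 ?addr_ge0 ?sqrtr_ge0 ?(ltW K0).
  rewrite exprMn ler_wpM2l// -sqr_enorm.
  by have := sqr_ge0 (1 - enorm p.1); nra.
have x0 := dotp_ge0 p.1; have z0 := dotp_ge0 p.2.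
by nra.
Qed.

(** * The viscosity inequalities at the maximum, and comparison *)

Section viscosity.
Variables (sigma : R) (v1 v2 : E -> R).
Hypothesis hv1 : viscosity_subsolution sigma (hamiltonian U A F1 F2 L) v1.
Hypothesis hv2 : viscosity_supersolution sigma (hamiltonian U A F1 F2 L) v2.

(** Freezing [q], then [p], makes the maximum a local maximum for [v1] and a local minimum for [v2].
    The quadratic terms have equal gradients at the two points, so only increments of [F1] and [F2]
    survive. *)
Lemma doubling_ineq a b c (t : E * E) :
  (forall s, doubled v1 v2 b c s - a * sqdist s.1.1 s.2.1
          <= doubled v1 v2 b c t - a * sqdist t.1.1 t.2.1) ->
  let: (p, q) := t in
  exists u d, [/\ controls U u, controls A d &
    sigma * (v1 p - v2 q) <=
      2 * a * dotp (F1 p.1 u d - F1 q.1 u d) (p.1 - q.1)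
      + 2 * b * dotp (p.2 - q.2) (F2 p.1 u d - F2 q.1 u d)
      + c * (2 / sqnorm1 p * drift p u d + 2 / sqnorm1 q * drift q u d)
      + (L p.1 p.2 u d - L q.1 q.2 u d)].
Proof.
case: t => p q tmax.
have max1 : local_max (fun r => v1 r - test a b c q r) p.
  apply: (@nearW _ (nbhs p)) => r.
  by have := tmax (r, q); rewrite /doubled /test /sqdist/=; lra.
(* [v2] enters [doubled] with a minus sign, hence the negated coefficients. *)
have min2 : local_min (fun r => v2 r - test (- a) (- b) (- c) p r) q.
  apply: (@nearW _ (nbhs q)) => r; have := tmax (p, r); rewrite /doubled /test.
  by rewrite /= !(sqdistC p.1) !(sqdistC p.2) /sqdist; lra.
have := hv1 (C1_test _ _ _ _) max1; have := hv2 (C1_test _ _ _ _) min2.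
rewrite !gradx_test !gradz_test.
(* First [d] is taken optimal at [p], then [u] optimal at [q] against this [d]. For this pair the
   integrand is below the Hamiltonian at [p] and above it at [q], as the sub- and supersolution
   inequalities require. *)
have [[d Ad hd] _] := hamiltonian_attained p.1 p.2
  ((2 * a) *: (p.1 - q.1) + (2 * c / sqnorm1 p) *: p.1)
  ((2 * b) *: (p.2 - q.2) + (2 * c / sqnorm1 p) *: p.2).
have [_ /(_ d Ad)[u Uu hu]] :=
  hamiltonian_attained q.1 q.2
  ((2 * - a) *: (q.1 - p.1) + (2 * - c / sqnorm1 q) *: q.1)
  ((2 * - b) *: (q.2 - p.2) + (2 * - c / sqnorm1 q) *: q.2).
move=> sup sub; exists u, d; split=> //.
have {hd} := hd u Uu; move: hu sup sub.
set Hp := hamiltonian _ _ _ _ _ p.1 _ _ _.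
set Hq := hamiltonian _ _ _ _ _ q.1 _ _ _.
rewrite /h /drift !dotpE !(dotpC _ p.1) !(dotpC _ q.1) !mulrN !mulNr.
set N1 := (sqnorm1 p)^-1; set N2 := (sqnorm1 q)^-1.
by lra.
Qed.

Lemma comparison (M : R) :
  (exists2 C : R, 0 < C &
     forall x x' u a, controls U u -> controls A a ->
       dotp (F1 x u a - F1 x' u a) (x - x') <= C * enorm (x - x') ^+ 2) ->
  (exists2 K : R, 0 < K &
     forall x u a, controls U u -> controls A a ->
       enorm (F2 x u a) <= K * (1 + enorm x)) ->
  (forall eps : R, 0 < eps -> exists2 delta : R, 0 < delta &
     forall u a (x x' : 'rV[R]_n), controls U u -> controls A a ->
       enorm (x - x') < delta -> enorm (F2 x u a - F2 x' u a) < eps) ->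
  (forall eps : R, 0 < eps -> exists2 delta : R, 0 < delta &
     forall u a (x x' : 'rV[R]_n) (z z' : 'rV[R]_n'), controls U u -> controls A a ->
       enorm (row_mx (x - x') (z - z')) < delta ->
       `|L x z u a - L x' z' u a| < eps) ->
  0 < sigma -> (forall p, `|v1 p| <= M) -> (forall p, `|v2 p| <= M) ->
  continuous v1 -> continuous v2 -> forall p, v1 p <= v2 p.
Proof.
move=> hF1 hF2 hF2unif hLunif sigma0 v1M v2M v1c v2c p0.
rewrite leNgt; apply/negP => v21.
have [K K0 hK] := drift_le hF1 hF2; have {hF1 hF2} [C C0 hF1] := hF1.
pose theta := v1 p0 - v2 p0.
have theta0 : 0 < theta by rewrite subr_gt0.
have M0 : 0 <= M by exact: le_trans (normr_ge0 _) (v1M p0).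
(* Error budget: the [F1] term, the drift term and the [L] term cost [e] each and the [F2] term
   [2 * e], against [sigma * theta / 2], which is [5 * e]. Strictness in the [L] term gives the
   contradiction. *)
pose e := sigma * theta / 10.
have e0 : 0 < e by rewrite divr_gt0// mulr_gt0.
pose P := penalty p0; have P0 : 0 <= P := penalty_ge0 p0.
(* The first bound keeps the value at [(p0, p0)] above [theta / 2]; the second makes the two drift
   terms cost at most [e]. *)
have [c c0 [cP cK]] : exists2 c : R, 0 < c & 2 * c * P <= theta / 2 /\ c * (K + K) <= e.
  pose c1 := theta / (4 * (P + 1)); pose c2 := e / (2 * K).
  have c1P : 2 * c1 * P <= theta / 2.
    have -> : 2 * c1 * P = theta / 2 * (P / (P + 1)) by rewrite /c1; field; lra.
    rewrite ler_piMr ?divr_ge0 ?(ltW theta0)// ler_pdivrMr; lra.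
  have c2K : c2 * (K + K) = e by rewrite /c2; field; rewrite gt_eqF.
  have [c12|c21] := leP c1 c2.
    exists c1; first by rewrite /c1 divr_gt0//; lra.
    by split => //; rewrite -c2K ler_wpM2r// addr_ge0 ?ltW.
  exists c2; first by rewrite /c2 divr_gt0//; lra.
  split; last by rewrite c2K.
  by apply: le_trans c1P; rewrite ler_wpM2r// ler_pM2l// ltW.
have [dL dL0 hL] := hLunif e e0.
(* The maximum satisfies [b * Z <= 2 * M], so this forces [2 * Z < dL ^+ 2]. *)
have [b b0 hb] : exists2 b : R, 0 < b & 4 * M < b * dL ^+ 2.
  exists ((4 * M + 1) / dL ^+ 2); first by rewrite divr_gt0 ?exprn_gt0//; lra.
  by rewrite divfK ?expf_neq0 ?gt_eqF//; lra.
(* [t] is the Young weight for the [F2] term: [t * (b * Z)] is then at most [e], and an increment of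
   [F2] with square at most [e * t / b] contributes another [e]. *)
have [t t0 ht] : exists2 t : R, 0 < t & t * (2 * M) <= e.
  exists (e / (2 * M + 1)); first by rewrite divr_gt0//; lra.
  rewrite mulrAC ler_pdivrMr; last lra.
  by rewrite ler_wpM2l ?ltW//; lra.
have r0 : 0 < e * t / b by rewrite divr_gt0// mulr_gt0.
have sqrt0 : 0 < Num.sqrt (e * t / b) by rewrite sqrtr_gt0.
have [dF dF0 hF] := hF2unif _ sqrt0.
(* Since [a * X <= 2 * M], these thresholds bring the [x] components within the moduli of [L] and
   [F2]; [dF] depends on [b], hence so does [a0]. *)
have [a0 a00 [ha1 ha2]] : exists2 a : R, 0 < a &
    4 * M < a * dL ^+ 2 /\ 2 * M < a * dF ^+ 2.
  pose a1 := (4 * M + 1) / dL ^+ 2; pose a2 := (2 * M + 1) / dF ^+ 2.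
  have a1_gt0 : 0 < a1 by rewrite /a1 divr_gt0 ?exprn_gt0//; lra.
  have a2_gt0 : 0 < a2 by rewrite /a2 divr_gt0 ?exprn_gt0//; lra.
  exists (a1 + a2); first exact: addr_gt0.
  have a1L : a1 * dL ^+ 2 = 4 * M + 1 by rewrite /a1 divfK ?expf_neq0 ?gt_eqF.
  have a2F : a2 * dF ^+ 2 = 2 * M + 1 by rewrite /a2 divfK ?expf_neq0 ?gt_eqF.
  have := mulr_ge0 (ltW a2_gt0) (sqr_ge0 dL).
  have := mulr_ge0 (ltW a1_gt0) (sqr_ge0 dF).
  by rewrite !mulrDl a1L a2F; lra.
have eC0 : 0 < e / (2 * C) by rewrite divr_gt0//; lra.
(* The target [e / (2 * C)] makes the one-sided Lipschitz contribution [2 * C * (a * X)] at most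
   [e]. *)
have [||||a [[p q] [a0a tmax aX]]] := @penalization_small R (E * E)%type
    (doubled v1 v2 b c) (fun s => sqdist s.1.1 s.2.1) (M + M) (0, 0)
    _ _ _ _ a0 (e / (2 * C)) a00 eC0.
- by move=> s; apply: doubled_le; rewrite ?ltW.
- by move=> s; exact: dotp_ge0.
- by rewrite /sqdist subrr dotp0r.
- by move=> a a_gt0; apply: (doubled_attained v1M v2M) => //; exact: ltW.
have a_gt0 : 0 < a by exact: lt_le_trans a0a.
have [u [d [Uu Ad]]] := doubling_ineq tmax.
(* On the diagonal both quadratic terms vanish, so the maximum is at least [theta - 2 * c * P]. *)
have := tmax (p0, p0); rewrite /doubled/= in aX *.
rewrite -/(sqdist p.1 q.1).
set X := sqdist p.1 q.1 in aX *; set Z := sqdist p.2 q.2.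
have X0 : 0 <= X := dotp_ge0 _; have Z0 : 0 <= Z := dotp_ge0 _.
rewrite /sqdist !subrr !dotp0r !mulr0 !subr0 -/theta -/P => max0 ineq.
have pen0 : 0 <= c * (penalty p + penalty q).
  by rewrite mulr_ge0 ?(ltW c0)// addr_ge0 ?penalty_ge0.
have v12 : v1 p - v2 q <= 2 * M.
  have := v1M p; have := v2M q; rewrite !ler_norml.
  by move=> /andP[? ?] /andP[? ?]; lra.
have gap : theta / 2 + a * X + b * Z <= v1 p - v2 q by lra.
have aX0 := mulr_ge0 (ltW a_gt0) X0; have bZ0 := mulr_ge0 (ltW b0) Z0.
have adL : a0 * dL ^+ 2 <= a * dL ^+ 2 by rewrite ler_wpM2r ?sqr_ge0.
have adF : a0 * dF ^+ 2 <= a * dF ^+ 2 by rewrite ler_wpM2r ?sqr_ge0.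
have XdF : X < dF ^+ 2 by rewrite -(ltr_pM2l a_gt0); lra.
(* The factor 2 here and for [Z] gives [X + Z < dL ^+ 2], the squared joint distance required by the
   modulus of [L]. *)
have XdL : 2 * X < dL ^+ 2 by rewrite -(ltr_pM2l a_gt0); lra.
have ZdL : 2 * Z < dL ^+ 2 by rewrite -(ltr_pM2l b0); lra.
have Lpq : L p.1 p.2 u d - L q.1 q.2 u d < e.
  apply: le_lt_trans (ler_norm _) (hL u d _ _ _ _ Uu Ad _).
  by apply: enorm_lt => //; rewrite dotp_row_mx; rewrite /X /Z /sqdist in XdL ZdL; lra.
have F1pq : 2 * a * dotp (F1 p.1 u d - F1 q.1 u d) (p.1 - q.1) <= e.
  have := hF1 p.1 q.1 u d Uu Ad; rewrite sqr_enorm -/(sqdist _ _) -/X => F1X.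
  apply: (@le_trans _ _ (2 * a * (C * X))); first by rewrite ler_pM2l// mulr_gt0.
  have -> : 2 * a * (C * X) = 2 * C * (a * X) by ring.
  by rewrite -ler_pdivlMl ?mulr_gt0// [leRHS]mulrC.
have F2pq : 2 * b * dotp (p.2 - q.2) (F2 p.1 u d - F2 q.1 u d) <= 2 * e.
  have := hF u d p.1 q.1 Uu Ad (enorm_lt dF0 XdF).
  set D := F2 _ _ _ - _ => Dlt.
  have DD : dotp D D <= e * t / b.
    rewrite -sqr_enorm -(sqr_sqrtr (ltW r0)).
    by apply: lerXn2r (ltW Dlt); rewrite nnegrE sqrtr_ge0.
  have := dotp_young (p.2 - q.2) D t0; rewrite -/(sqdist _ _) -/Z => young.
  apply: (@le_trans _ _ (b * (t * Z + t^-1 * (e * t / b)))).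
    rewrite mulrAC mulrC ler_pM2l//; apply: le_trans young _.
    by rewrite lerD2l ler_pM2l ?invr_gt0.
  have -> : b * (t * Z + t^-1 * (e * t / b)) = t * (b * Z) + e.
    by field; rewrite !gt_eqF.
  have : t * (b * Z) <= t * (2 * M) by rewrite ler_pM2l//; lra.
  by lra.
have drifts : c * (2 / sqnorm1 p * drift p u d + 2 / sqnorm1 q * drift q u d) <= e.
  by apply: le_trans cK; rewrite ler_pM2l// lerD// hK.
have : sigma * (theta / 2) <= sigma * (v1 p - v2 q) by rewrite ler_pM2l//; lra.
have : sigma * theta = 10 * e by rewrite /e; field.
by lra.
Qed.

End viscosity.
End comparison.

Unset Implicit Arguments.
Set Strict Implicit.

Theorem lemma4p1 (R : realType) (n n' m m' : nat)
    (U : set 'rV[R]_m) (A : set 'rV[R]_m')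
    (F1 : 'rV[R]_n -> 'rV[R]_m -> 'rV[R]_m' -> 'rV[R]_n)
    (F2 : 'rV[R]_n -> 'rV[R]_m -> 'rV[R]_m' -> 'rV[R]_n')
    (L : 'rV[R]_n -> 'rV[R]_n' -> 'rV[R]_m -> 'rV[R]_m' -> R)
    (hU : compact U) (hA : compact A)
    (hUA : ~ (U = set0 /\ A = set0))
    (hLcont : {within (setT : set ('rV[R]_n * 'rV[R]_n')) `*` controls U `*` controls A,
       continuous (fun q : ('rV[R]_n * 'rV[R]_n') * 'rV[R]_m * 'rV[R]_m' =>
                     L q.1.1.1 q.1.1.2 q.1.2 q.2)})
    (hF1cont : {within (setT : set 'rV[R]_n) `*` controls U `*` controls A,
       continuous (fun q : 'rV[R]_n * 'rV[R]_m * 'rV[R]_m' => F1 q.1.1 q.1.2 q.2)})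
    (hF2cont : {within (setT : set 'rV[R]_n) `*` controls U `*` controls A,
       continuous (fun q : 'rV[R]_n * 'rV[R]_m * 'rV[R]_m' => F2 q.1.1 q.1.2 q.2)})
    (hF1 : exists2 C : R, 0 < C &
       forall x x' u a, controls U u -> controls A a ->
         dotp (F1 x u a - F1 x' u a) (x - x') <= C * enorm (x - x') ^+ 2)
    (hF2growth : exists2 K : R, 0 < K &
       forall x u a, controls U u -> controls A a ->
         enorm (F2 x u a) <= K * (1 + enorm x))
    (hF2unif : forall eps : R, 0 < eps -> exists2 delta : R, 0 < delta &
       forall u a (x x' : 'rV[R]_n), controls U u -> controls A a ->
         enorm (x - x') < delta -> enorm (F2 x u a - F2 x' u a) < eps)
    (hLbdd : exists M : R, forall x z u a, controls U u -> controls A a ->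
       `|L x z u a| <= M)
    (hLunif : forall eps : R, 0 < eps -> exists2 delta : R, 0 < delta &
       forall u a (x x' : 'rV[R]_n) (z z' : 'rV[R]_n'), controls U u -> controls A a ->
         enorm (row_mx (x - x') (z - z')) < delta ->
         `|L x z u a - L x' z' u a| < eps)
    (sigma : R) (hsigma : 0 < sigma)
    (v1 v2 : 'rV[R]_n * 'rV[R]_n' -> R)
    (hv1bdd : exists M : R, forall p, `|v1 p| <= M)
    (hv2bdd : exists M : R, forall p, `|v2 p| <= M)
    (hv1cont : continuous v1) (hv2cont : continuous v2)
    (hv1 : viscosity_subsolution sigma (hamiltonian U A F1 F2 L) v1)
    (hv2 : viscosity_supersolution sigma (hamiltonian U A F1 F2 L) v2) :
  forall (x : 'rV[R]_n) (z : 'rV[R]_n'), v1 (x, z) <= v2 (x, z).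
Proof.
move=> x z; have [M1 v1M] := hv1bdd; have [M2 v2M] := hv2bdd.
have M10 := le_trans (normr_ge0 _) (v1M (x, z)).
have M20 := le_trans (normr_ge0 _) (v2M (x, z)).
apply: (@comparison _ _ _ _ _ U A F1 F2 L hU hA hLcont hF1cont hF2cont sigma
  v1 v2 hv1 hv2 (M1 + M2)) => // p.
  by apply: le_trans (v1M p) _; rewrite lerDl.
by apply: le_trans (v2M p) _; rewrite lerDr.
Qed.
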